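(* There is a deterministic algorithm that, given a string $T$ of length $n$ over a general unordered alphabet and containing $\sigma$ distinct symbols (the value $\sigma$ is not given to the algorithm), determines whether $T$ is square-free using $\mathcal{O}(n \log \sigma)$ comparisons.
   Context: General unordered alphabet: the algorithm can access the input string $T[1..n]$ only through queries ''is $T[i]=T[j]$?'' for positions $i,j$; each query is one comparison, and no order on the symbols is available. A square is a fragment $T[s..s+2\ell-1]$ with $\ell\ge 1$ and $T[s..s+\ell-1]=T[s+\ell..s+2\ell-1]$; a string is square-free if it contains no square. *)

(* Defs.v *)
From mathcomp Require Import all_boot all_order all_algebra.
From mathcomp Require Import reals exp.

Set Implicit Arguments.
Unset Strict Implicit.
Unset Printing Implicit Defensive.

Import GRing.Theory Num.Theory.

(* A deterministic algorithm on strings of length n over a general unordered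
   alphabet: the only access to the string is the test "T[i] = T[j]?", and the
   next step depends only on the outcomes so far. Computation between
   comparisons is free. Neither the alphabet nor the number of distinct symbols
   is a parameter. *)
Inductive eq_tree (n : nat) : Type :=
| Answer (b : bool)
| Compare (i j : 'I_n) (if_eq if_neq : eq_tree n).

Section Run.
Variables (n : nat) (Sigma : eqType) (T : n.-tuple Sigma).

Fixpoint answer (t : eq_tree n) : bool :=
  match t with
  | Answer b => b
  | Compare i j t1 t2 =>
      if tnth T i == tnth T j then answer t1 else answer t2
  end.

Fixpoint comparisons (t : eq_tree n) : nat :=
  match t with
  | Answer _ => 0
  | Compare i j t1 t2 =>
      (if tnth T i == tnth T j then comparisons t1 else comparisons t2).+1
  end.

End Run.

Section Strings.
Variable Sigma : eqType.
Implicit Type T : seq Sigma.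

(* T[s .. s+len-1], with positions counted from 0 *)
Definition fragment T (s len : nat) : seq Sigma := take len (drop s T).

(* T[s .. s+2l-1] is a square. The bound on s + 2l is needed because
   [fragment] truncates at the end of T. *)
Definition square_at T (s l : nat) : Prop :=
  [/\ 1 <= l, s + l.*2 <= size T & fragment T s l = fragment T (s + l) l].

Definition square_free T : Prop := forall s l : nat, ~ square_at T s l.

Definition num_symbols T : nat := size (undup T).

End Strings.

Local Open Scope ring_scope.

(* The quantity inside O(n log sigma). For sigma <= 1 the logarithm is replaced
   by 1: the string aa cannot be decided with 0 comparisons. *)
Definition n_log (R : realType) (n sigma : nat) : R :=
  n%:R * Num.max 1 (ln sigma%:R / ln 2).

(* Main.v *)
(* A comparison with outcome "equal" that is not implied by the earlier answers
   merges two classes of positions known to carry the same symbol, so there are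
   fewer than n of those; only mismatches have to be counted, and extending two
   matching positions as far as possible costs a single mismatch.

   Fix a scale r and put h = r^2. If T contains a square whose period p lies
   between about 3h and 256h, some position x of its first half is among the
   first r positions of a block of length h, while x + p is a multiple of r.
   So it suffices to find, among the O(r) such samples of two nearby blocks, the
   pairs whose fragments of length h agree, and to extend them to both sides. Two
   partners of x in the same block overlap and already give a square, hence one
   extension per x is enough. The longest common prefixes of the samples, capped
   at h, form an ultrametric; they are computed by inserting the samples one by
   one into their trie; each insertion costs q mismatches with q <= 2r and
   q^2 <= 8 sigma^2 r. Thus the scale costs O(n min(1, sigma / sqrt r)), and the
   sum over r = 4^j is O(n log sigma), without knowing sigma. *)
Require Import Defs.
From mathcomp Require Import all_boot all_order all_algebra.
From mathcomp Require Import reals exp.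
From mathcomp Require Import zify.

Set Implicit Arguments.
Unset Strict Implicit.
Unset Printing Implicit Defensive.

(** * Comparison programs and the algorithm *)

Inductive prog (A : Type) : Type :=
| Ret (a : A)
| Cmp (i j : nat) (k : bool -> prog A).

Fixpoint bind A B (p : prog A) (g : A -> prog B) : prog B :=
  match p with
  | Ret a => g a
  | Cmp i j k => Cmp i j (fun b => bind (k b) g)
  end.

(** There is no short-circuit: every program in the list runs, so mismatch counts simply add up. *)
Fixpoint orM (ps : seq (prog bool)) : prog bool :=
  if ps is p :: ps' then bind p (fun b => bind (orM ps') (fun b' => Ret (b || b')))
  else Ret false.

Fixpoint scan (l : seq (nat * nat)) : prog nat :=
  if l is ij :: l' then
    Cmp ij.1 ij.2 (fun b => if b then bind (scan l') (fun m => Ret m.+1) else Ret 0)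
  else Ret 0.

Definition scan_right x y m := scan [seq (x + k, y + k) | k <- iota 0 m].
(** Offsets start at 1 because the pair (x, y) itself belongs to the rightward scan; k < x keeps the
    subtractions exact when x <= y. *)
Definition scan_left x y := scan [seq (x - k.+1, y - k.+1) | k <- iota 0 x].

(** The worst-case number of candidates that survive a mismatch against y, over all depths where it
    can occur. *)
Definition score (L : nat -> nat -> nat) h C y :=
  \max_(l < h) count (fun z => L y z == l) C.

Definition pivot L h y0 C :=
  foldr (fun z y => if score L h (y0 :: C) z < score L h (y0 :: C) y then z else y) y0 C.

(* L holds the common prefix lengths within C. If x and the pivot y agree on
   exactly l < h symbols, then lcp x z is min (L y z) l unless L y z = l. *)
Fixpoint search (L : nat -> nat -> nat) h x fuel C : prog (nat -> nat) :=
  match fuel, C with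
  | fuel'.+1, y0 :: C' =>
      let y := pivot L h y0 C' in
      bind (scan_right x y h) (fun l =>
        if l == h then Ret (L y) else
        bind (search L h x fuel' [seq z <- C | L y z == l]) (fun row =>
          Ret (fun z => if L y z == l then row z else minn (L y z) l)))
  | _, _ => Ret (fun=> 0)
  end.

Fixpoint lcp_table h xs : prog (nat -> nat -> nat) :=
  if xs is x :: xs' then
    bind (lcp_table h xs') (fun L =>
    bind (search L h x (size xs') xs') (fun row =>
      Ret (fun y z => if y == x then if z == x then h else row z
                      else if z == x then row y else L y z)))
  else Ret (fun _ _ => 0).

Definition check_pair n x y : prog bool :=
  bind (scan_right x y (n - y)) (fun right =>
  bind (scan_left x y) (fun left => Ret (y - x <= left + right))).

(* For two or more matches the answer is known without comparisons, see
   check_matches_sound. *)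
Definition check_matches n x Q : prog bool :=
  match Q with
  | [::] => Ret false
  | [:: y] => check_pair n x y
  | _ => Ret true
  end.

(* Samples x of block [c r^2, (c+1) r^2) whose fragment of length r^2 fits in the
   string: a square is found as a pair (x, y) with x dense
   in block c and y sparse in block c + b, where b <= 256 as periods are < 256 r^2. *)
Definition dense n r c := [seq x <- iota (c * r ^ 2) r | x + r ^ 2 <= n].
Definition sparse n r c :=
  [seq y <- [seq c * r ^ 2 + r * i | i <- iota 0 r] | y + r ^ 2 <= n].

Definition window n r c b : prog bool :=
  bind (lcp_table (r ^ 2) (dense n r c ++ sparse n r (c + b))) (fun L =>
    orM [seq check_matches n x
               [seq y <- sparse n r (c + b) | (x < y) && (L x y == r ^ 2)]
        | x <- dense n r c]).

Definition scale n r : prog bool :=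
  if r ^ 2 <= n then
    orM [seq orM [seq window n r c b | b <- iota 0 257] | c <- iota 0 (n %/ r ^ 2).+1]
  else Ret false.

Definition has_square n : prog bool := orM [seq scale n (4 ^ j) | j <- iota 0 n].

(** * Results and mismatch counts of programs *)

Section Semantics.
Variables (D : eqType) (f : nat -> D).

Fixpoint run A (p : prog A) : A :=
  match p with
  | Ret a => a
  | Cmp i j k => run (k (f i == f j))
  end.

Fixpoint mism A (p : prog A) : nat :=
  match p with
  | Ret _ => 0
  | Cmp i j k => (f i != f j) + mism (k (f i == f j))
  end.

Lemma run_bind A B (p : prog A) (g : A -> prog B) : run (bind p g) = run (g (run p)).
Proof. by elim: p => //= i j k IH. Qed.

Lemma mism_bind A B (p : prog A) (g : A -> prog B) :
  mism (bind p g) = mism p + mism (g (run p)).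
Proof. by elim: p => //= i j k IH; rewrite IH addnA. Qed.

Lemma run_orM (I : eqType) (F : I -> prog bool) s :
  run (orM [seq F i | i <- s]) = has (fun i => run (F i)) s.
Proof. by elim: s => //= i s IH; rewrite !run_bind /= IH. Qed.

Lemma mism_orM (I : eqType) (F : I -> prog bool) s :
  mism (orM [seq F i | i <- s]) = \sum_(i <- s) mism (F i).
Proof.
elim: s => [|i s IH] /=; first by rewrite big_nil.
by rewrite big_cons !mism_bind /= addn0 IH.
Qed.

Lemma mism_orM_le (I : eqType) (F : I -> prog bool) s m :
  {in s, forall i, mism (F i) <= m} -> mism (orM [seq F i | i <- s]) <= size s * m.
Proof.
move=> le_m; rewrite mism_orM big_seq (leq_trans (leq_sum _ le_m)) //.
by rewrite -big_seq big_const_seq count_predT iter_addn_0 mulnC.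
Qed.

Lemma run_scan l : run (scan l) = find (fun ij => f ij.1 != f ij.2) l.
Proof. by elim: l => //= -[i j] l IH /=; case: eqP => //= _; rewrite run_bind IH. Qed.

Lemma mism_scan l : mism (scan l) = has (fun ij => f ij.1 != f ij.2) l.
Proof.
by elim: l => //= -[i j] l IH /=; case: eqP => //= _; rewrite mism_bind IH addn0.
Qed.

(** * Capped longest common prefixes *)

Definition lcp h x y := find (fun k => f (x + k) != f (y + k)) (iota 0 h).

Lemma run_scan_right x y m : run (scan_right x y m) = lcp m x y.
Proof. by rewrite run_scan find_map. Qed.

Lemma mism_scan_right x y m : mism (scan_right x y m) = (lcp m x y < m).
Proof. by rewrite mism_scan has_map /lcp has_find size_iota. Qed.

Lemma lcp_max h x y : lcp h x y <= h.
Proof. by rewrite -[leqRHS](size_iota 0) find_size. Qed.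

Lemma find_iotaP (a : pred nat) m k :
  reflect (k <= m /\ forall i, i < k -> ~~ a i) (k <= find a (iota 0 m)).
Proof.
have le_m : find a (iota 0 m) <= m by rewrite -[leqRHS](size_iota 0) find_size.
apply: (iffP idP) => [le_k | [le_km na]].
  split=> [|i lt_ik]; first exact: leq_trans le_k le_m.
  have lt_i := leq_trans lt_ik le_k.
  by have /negbT := before_find 0 lt_i; rewrite nth_iota // (leq_trans lt_i).
rewrite leqNgt; apply/negP => lt_k; have lt_m := leq_trans lt_k le_km.
have := nth_find 0 (s := iota 0 m) (a := a).
rewrite has_find size_iota nth_iota // => /(_ lt_m).
by apply/negP/na.
Qed.

Lemma lcpP h x y k :
  reflect (k <= h /\ forall i, i < k -> f (x + i) = f (y + i)) (k <= lcp h x y).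
Proof.
apply: (iffP (find_iotaP _ _ _)) => -[le_kh eq_f]; split=> // i lt_ik.
  by apply/eqP; rewrite -[_ == _]negbK eq_f.
by rewrite negbK eq_f.
Qed.

Lemma lcpC h x y : lcp h x y = lcp h y x.
Proof. by apply: eq_find => k; rewrite eq_sym. Qed.

Lemma lcpxx h x : lcp h x x = h.
Proof. by apply/eqP; rewrite eqn_leq lcp_max; apply/lcpP. Qed.

Lemma lcp_trans h x y z : minn (lcp h x y) (lcp h y z) <= lcp h x z.
Proof.
apply/lcpP; split=> [|i]; first by rewrite geq_min lcp_max.
rewrite leq_min => /andP[lt_xy lt_yz].
by have [[_ ->] // [_ ->]] := (lcpP _ _ _ _ lt_xy, lcpP _ _ _ _ lt_yz).
Qed.

(** Ultrametric law: among the three prefix lengths of x, y and z, the two smallest coincide. *)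
Lemma lcp_neq h x y z :
  lcp h y z != lcp h x y -> lcp h x z = minn (lcp h y z) (lcp h x y).
Proof.
have := lcp_trans h x y z; have := lcp_trans h y x z; have := lcp_trans h y z x.
rewrite (lcpC h y x) (lcpC h z x); lia.
Qed.

(** * Correctness of the trie search *)

Lemma foldr_argmin (s : nat -> nat) y0 C (w := foldr (fun z y => if s z < s y then z else y) y0 C) :
  w \in y0 :: C /\ {in y0 :: C, forall z, s w <= s z}.
Proof.
rewrite {}/w; elim: C => [|z C [IHin IHmin]] /=.
  by split=> [|z]; rewrite inE // => /eqP->.
case: ifP => lt_s; split.
- by rewrite !inE eqxx orbT.
- move=> u; rewrite !inE => /or3P[/eqP->|/eqP->|uC] //.
    by rewrite ltnW // (leq_trans lt_s) // IHmin ?mem_head.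
  by rewrite ltnW // (leq_trans lt_s) // IHmin // inE uC orbT.
- by move: IHin; rewrite !inE => /orP[->|->]; rewrite ?orbT.
- move=> u; rewrite !inE => /or3P[/eqP->|/eqP->|uC].
  + by rewrite IHmin ?mem_head.
  + by rewrite leqNgt lt_s.
  + by rewrite IHmin // inE uC orbT.
Qed.

Lemma pivot_in L h y0 C : pivot L h y0 C \in y0 :: C.
Proof. by case: (foldr_argmin (score L h (y0 :: C)) y0 C). Qed.

Lemma count_lt_size (a : pred nat) s y : y \in s -> ~~ a y -> count a s < size s.
Proof.
move=> ys nay; rewrite -(count_predC a s) -addn1 leq_add2l -has_count.
by apply/hasP; exists y.
Qed.

Lemma run_search L h x fuel C :
  {in C &, forall y z, L y z = lcp h y z} -> size C <= fuel ->
  {in C, run (search L h x fuel C) =1 lcp h x}.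
Proof.
elim: fuel C => [|fuel IH] [|y0 C] //= HL; rewrite ltnS => szC z zC.
set y := pivot _ _ _ _; have yC : y \in y0 :: C by apply: pivot_in.
rewrite run_bind run_scan_right; case: eqP => [eq_h|neq_h] /=.
  have [eq_yz|] := eqVneq (lcp h y z) h; last first.
    by rewrite -{2}eq_h HL // => /lcp_neq->; rewrite eq_h; apply/esym/minn_idPl/lcp_max.
  rewrite HL // eq_yz; apply/esym/eqP; rewrite eqn_leq lcp_max.
  by have := lcp_trans h x y z; rewrite eq_h eq_yz minnn.
rewrite run_bind /= -/(filter _ (y0 :: C)).
have [eq_l|neq_l] := eqVneq; last by rewrite HL // -lcp_neq // -HL.
apply: IH; last by rewrite mem_filter eq_l eqxx.
  by move=> u v; rewrite !mem_filter => /andP[_ uC] /andP[_ vC]; apply: HL.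
(* The pivot is filtered out, as its prefix length with itself is h and not l; hence the fuel
   suffices. *)
rewrite size_filter -ltnS (leq_trans _ (szC : size (y0 :: C) <= fuel.+1)) //.
by apply: (count_lt_size yC); rewrite HL // lcpxx eq_sym; apply/eqP.
Qed.

Lemma run_lcp_table h xs : {in xs &, run (lcp_table h xs) =2 lcp h}.
Proof.
elim: xs => //= x xs IH y z; rewrite !run_bind /= !inE.
have row := @run_search _ h x _ _ IH (leqnn _).
have [->|_] := eqVneq y x; have [->|_] := eqVneq z x; rewrite ?lcpxx //= => yxs zxs.
- exact: row.
- by rewrite lcpC row.
- exact: IH.
Qed.

(** * Mismatch bounds over a small alphabet *)

Section FewLetters.
Variable U : seq D.

(** Pigeonhole, removing one letter at a time: the larger of the class of [a] and the best class
    among the rest is taken. *)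
Lemma popular_letter (g : nat -> D) (C : seq nat) :
    {in C, forall z, g z \in U} -> C != [::] ->
  exists2 z, z \in C & size C <= size U * count (fun u => g u == g z) C.
Proof.
elim: U C => [|a V IH] C gC; first by case: C gC => // z C /(_ z (mem_head _ _)).
pose C' := [seq u <- C | g u != a].
have sz : size C = count (fun u => g u == a) C + size C'.
  by rewrite size_filter count_predC.
move=> C0; have [C'0|C'N0] := eqVneq C' [::].
  case: C C0 gC @C' C'0 sz => // z C _ _ C' C'0; rewrite C'0 addn0 => sz.
  have /eqP gz : g z == a.
    by apply: contraT => gz; move: C'0; rewrite /C' /= gz.
  by exists z; rewrite ?mem_head // gz -sz mulSn leq_addr.
have [u|z zC' le_z] := IH C' _ C'N0.
  by rewrite mem_filter => /andP[+ /gC]; rewrite inE => /negPf->.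
have zC : z \in C by move: zC'; rewrite mem_filter => /andP[].
have le_C' : count (fun u => g u == g z) C' <= count (fun u => g u == g z) C.
  by apply: leq_count_subseq; apply: filter_subseq.
have := leq_mul (leqnn (size V)) le_C'.
have [le_a|/ltnW le_a] := leqP (count (fun u => g u == a) C) (count (fun u => g u == g z) C).
  by exists z => //; rewrite /= mulSn; lia.
have [a0|] := posnP (count (fun u => g u == a) C).
  by exists z => //; rewrite /= mulSn; lia.
rewrite -has_count => /hasP[w wC /eqP gw]; exists w => //; rewrite gw /= mulSn.
have := leq_mul (leqnn (size V)) le_a; lia.
Qed.

(* Following the most popular next letter at every depth leads to a leaf of the
   trie of C: at each branching node off this path, at most a fraction
   1 - 1/|U| of the positions split away. *)
Lemma heavy_path h d (C : seq nat) :
    {in C, forall z i, i < h -> f (z + i) \in U} -> C != [::] -> d <= h ->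
    {in C &, forall y z, d <= lcp h y z} ->
  exists2 y, y \in C & forall l, l < h ->
    size U * count (fun z => lcp h y z == l) C + size C <= size U * size C.
Proof.
move: {2}(h - d) (erefl (h - d)) => k.
elim: k d C => [|k IH] d C hd UC CN0 dh lcpC.
  case: C CN0 UC lcpC => // y C _ UC lcp_d; exists y => [|l lt_lh]; first exact: mem_head.
  have U0 : 0 < size U by have := UC y (mem_head _ _) _ lt_lh; case: (U).
  rewrite (_ : count _ _ = 0) ?muln0 ?leq_pmull //.
  apply/eqP; rewrite -leqn0 leqNgt -has_count; apply/hasPn => z zC.
  by have := lcp_d y z (mem_head _ _) zC; lia.
have lt_dh : d < h by lia.
have [z0 z0C le_z0] := popular_letter (g := fun z => f (z + d)) (fun z zC => UC z zC d lt_dh) CN0.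
pose C' := [seq z <- C | f (z + d) == f (z0 + d)].
have sC' z : z \in C' -> z \in C by rewrite mem_filter => /andP[].
have fC' z : z \in C' -> f (z + d) = f (z0 + d) by rewrite mem_filter => /andP[/eqP].
have C'N0 : C' != [::].
  by apply/eqP => C'0; have := in_nil z0; rewrite -C'0 mem_filter eqxx z0C.
have lcpC' : {in C' &, forall y z, d < lcp h y z}.
  move=> y z yC zC; apply/lcpP; split=> // i; rewrite ltnS leq_eqVlt => /orP[/eqP->|].
    by rewrite !fC'.
  by have /lcpP[_] := lcpC y z (sC' y yC) (sC' z zC); apply.
have [||y yC' le_y] := IH d.+1 C' _ _ C'N0 lt_dh lcpC'; first by lia.
  by move=> z /sC'; apply: UC.
exists y; first exact: sC'.
move=> l lt_lh; have le_yl := le_y l lt_lh.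
have U0 : 0 < size U by have := UC z0 z0C _ lt_dh; case: (U).
have szC' : size C' = count (fun z => f (z + d) == f (z0 + d)) C by rewrite size_filter.
have leC' : size C' <= size C by rewrite szC' count_size.
(* Nothing branches off before depth d; classes deeper than d lie inside [C']; the class at depth d
   is disjoint from [C'], which holds at least a fraction 1/|U| of [C]. *)
have [lt_ld|lt_dl|eq_ld] := ltngtP l d.
- rewrite (_ : count _ C = 0) ?muln0 ?leq_pmull //.
  apply/eqP; rewrite -leqn0 leqNgt -has_count; apply/hasPn => z zC.
  by have := lcpC y z (sC' y yC') zC; lia.
- suff le_cnt : count (fun z => lcp h y z == l) C <= count (fun z => lcp h y z == l) C'.
    have := leq_mul (leqnn (size U).-1) leC'; have := leq_mul (leqnn (size U)) le_cnt.
    by move: U0 le_yl; case: (size U) => //= u _; rewrite !mulSn; lia.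
  rewrite count_filter; apply: sub_count => z /= /eqP eq_l; rewrite eq_l eqxx /= -(fC' y yC').
  have /lcpP[_ /(_ d)->//] : d < lcp h y z by rewrite eq_l.
- suff: count (fun z => lcp h y z == l) C + size C' <= size C by move: le_z0; rewrite -szC'; nia.
  rewrite szC' -count_predUI (_ : count (predI _ _) C = 0) ?addn0 ?count_size //.
  apply/eqP; rewrite -leqn0 leqNgt -has_count; apply/hasPn => z zC /=.
  apply/negP => /andP[/eqP lcp_l fz]; have zC' : z \in C' by rewrite mem_filter fz.
  by have := lcpC' y z yC' zC'; lia.
Qed.

(** The leaf of the heavy path has a small score, and the pivot minimises the score. *)
Lemma pivot_split L h y0 C (y := pivot L h y0 C) l :
    {in y0 :: C &, forall y z, L y z = lcp h y z} ->
    {in y0 :: C, forall z i, i < h -> f (z + i) \in U} -> l < h ->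
  size U * count (fun z => L y z == l) (y0 :: C) + size (y0 :: C) <= size U * size (y0 :: C).
Proof.
move=> HL UC lt_lh.
have [//|//|u v _ _|w wC heavy] := @heavy_path h 0 (y0 :: C) UC; first by [].
have U0 : 0 < size U by have := UC y0 (mem_head _ _) _ lt_lh; case: (U).
have [_ /(_ w wC) le_score] := foldr_argmin (score L h (y0 :: C)) y0 C.
have: size U * score L h (y0 :: C) w + size (y0 :: C) <= size U * size (y0 :: C).
  rewrite /score; elim/big_ind: _ => [|m1 m2 le1 le2|i _].
  - by rewrite muln0 leq_pmull.
  - by case: (leqP m1 m2).
  - by rewrite (eq_in_count (a2 := fun z => lcp h w z == i)) ?heavy // => z zC /=; rewrite HL.
have := leq_bigmax (Ordinal lt_lh) (F := fun i : 'I_h => count (fun z => L y z == i) (y0 :: C)).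
rewrite -/(score _ _ _ _) /=.
move: (count _ _) (score _ _ _ y) (score _ _ _ w) le_score (size _) (size U) => a b c.
nia.
Qed.

(** Each mismatch shrinks the candidates by a factor 1 - 1/|U|. The square-root bound avoids
    logarithms and still decays relative to the scale. *)
Lemma mism_search L h x fuel C (q := mism (search L h x fuel C)) :
    {in C &, forall y z, L y z = lcp h y z} ->
    {in C, forall z i, i < h -> f (z + i) \in U} ->
  q <= size C /\ q ^ 2 <= 4 * size U ^ 2 * size C.
Proof.
rewrite {}/q; elim: fuel C => [|fuel IH] [|y0 C] // HL UC.
rewrite [search _ _ _ _ _]/=; set y := pivot _ _ _ _.
have yC : y \in y0 :: C by apply: pivot_in.
rewrite mism_bind run_scan_right mism_scan_right.
have [->|neq_h] := eqVneq (lcp h x y) h; first by rewrite ltnn.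
have lt_h : lcp h x y < h by rewrite ltn_neqAle neq_h lcp_max.
rewrite lt_h mism_bind /= -/(filter _ (y0 :: C)) addn0.
set C' := filter _ _.
have sC' z : z \in C' -> z \in y0 :: C by rewrite mem_filter => /andP[].
have [||] := IH C'; first by move=> u v /sC' uC /sC' vC; apply: HL.
  by move=> z /sC'; apply: UC.
have := pivot_split HL UC lt_h; rewrite -/y -size_filter -/C' /=.
have : size C' < (size C).+1.
  by rewrite size_filter; apply: (@count_lt_size _ (y0 :: C) _ yC); rewrite HL // lcpxx eq_sym.
have U0 : 0 < size U by have := UC y0 (mem_head _ _) _ lt_h; case: (U).
move: (mism _) (size C') (size C) (size U) U0 => q c' c u u0 /= lt_c' le_u le_q le_q2.
split; first lia.
(* Passing from c+1 to c' candidates lowers the bound by at least 4u(c+1), which pays for (q+1)^2 -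
   q^2 = 2q+1 <= 4uc'+1. *)
have le2 : q <= 2 * u * c'.
  by rewrite -leq_sqr (leq_trans le_q2) // !expnMn leq_mul //; case: (c') => // k; apply: leq_pmulr.
have := leq_mul (leqnn (4 * u)) le_u; have := leq_mul (leqnn (4 * u)) lt_c'.
rewrite !expnS !expn0 in le_q2 *; nia.
Qed.

(** The bound m stays abstract so that both q <= N and the square-root bound can be plugged in. *)
Lemma mism_lcp_table h xs N m :
    size xs <= N -> {in xs, forall z i, i < h -> f (z + i) \in U} ->
    (forall q, q <= N -> q ^ 2 <= 4 * size U ^ 2 * N -> q <= m) ->
  mism (lcp_table h xs) <= size xs * m.
Proof.
elim: xs => //= x xs IH szN UC bound; rewrite !mism_bind /= addn0 mulSn addnC leq_add //.
  have UC' z (zxs : z \in xs) := UC z (mem_behead (s := x :: xs) zxs).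
  have [le_q le_q2] := mism_search x (size xs) (@run_lcp_table h xs) UC'.
  by apply: bound; [lia | apply: leq_trans le_q2 _; rewrite leq_mul2l; lia].
by apply: IH => [|z zxs|]; [lia | apply: UC; rewrite inE zxs orbT |].
Qed.

Lemma mism_check_matches n x Q : mism (check_matches n x Q) <= 2.
Proof.
case: Q => [|y [|]] //=; rewrite /check_pair !mism_bind !mism_scan /= addn0.
by rewrite (leq_add (leq_b1 _) (leq_b1 _)).
Qed.

Lemma size_dense n r c : size (dense n r c) <= r.
Proof. by rewrite size_filter -[leqRHS](size_iota (c * r ^ 2)) count_size. Qed.

Lemma size_sparse n r c : size (sparse n r c) <= r.
Proof.
by rewrite size_filter (leq_trans (count_size _ _)) // size_map size_iota.
Qed.

Variables (n r m : nat).
Hypothesis UT : forall i, i < n -> f i \in U.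
Hypothesis bound : forall q, q <= r.*2 -> q ^ 2 <= 4 * size U ^ 2 * r.*2 -> q <= m.

Lemma mism_window c b : mism (window n r c b) <= r.*2 * m.+1.
Proof.
rewrite mism_bind mulnSr leq_add //.
  have sz : size (dense n r c ++ sparse n r (c + b)) <= r.*2.
    by rewrite size_cat -addnn leq_add ?size_dense ?size_sparse.
  apply: leq_trans (mism_lcp_table sz _ bound) _; last by rewrite leq_mul2r sz orbT.
  move=> z; rewrite mem_cat !mem_filter => /orP[]/andP[le_n _] i lt_i; apply: UT; lia.
apply: leq_trans (mism_orM_le (m := 2) _) _ => [x _|]; first exact: mism_check_matches.
by rewrite -muln2 leq_mul2r size_dense.
Qed.

Lemma mism_scale : 0 < r -> mism (scale n r) * r <= 1028 * n * m.+1.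
Proof.
move=> r0; rewrite /scale; case: ifP => // le_rn.
have le1 : mism (orM [seq orM [seq window n r c b | b <- iota 0 257] | c <- iota 0 (n %/ r ^ 2).+1])
    <= (n %/ r ^ 2).+1 * (257 * (r.*2 * m.+1)).
  rewrite -[X in X * (257 * _)](size_iota 0); apply: mism_orM_le => c _.
  by rewrite -[257](size_iota 0 257); apply: mism_orM_le => b _; apply: mism_window.
(* The extra block is absorbed by r^2 <= n. *)
have le2 : (n %/ r ^ 2).+1 * r ^ 2 <= 2 * n.
  by rewrite mulSn mul2n -addnn leq_add // leq_trunc_div.
apply: leq_trans (leq_mul le1 (leqnn r)) _.
have := leq_mul le2 (leqnn (514 * m.+1)).
move: (_ %/ _).+1 (m.+1) => a b; rewrite !expnS expn0; lia.
Qed.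

End FewLetters.

(** * Summation over the scales *)

Lemma sum_geometric_tail (c : nat -> nat) a M t n :
    (forall j, c j <= a) -> (forall i, c (t + i) * 2 ^ i <= M) ->
  \sum_(0 <= j < n) c j <= t * a + 2 * M.
Proof.
move=> le_a le_M; apply: (@leq_trans (\sum_(0 <= j < t + n) c j)).
  by rewrite addnC [leqRHS](big_cat_nat (n := n)) ?leq_addr //=.
rewrite (big_cat_nat (n := t)) ?leq_addr //=; apply: leq_add.
  rewrite (leq_trans (leq_sum _ (fun j _ => le_a j))) //.
  by rewrite sum_nat_const_nat subn0.
rewrite -{1}[t]add0n big_addn addKn; set S := \sum_(_ <= _ < _) _.
(* This is S <= 2M(1 - 2^-n), cleared of denominators. *)
suff: S * 2 ^ n + 2 * M <= 2 * M * 2 ^ n.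
  by move=> le_S; rewrite -(leq_pmul2r (expn_gt0 2 n)); lia.
rewrite {}/S; elim: n => [|n IH]; first by rewrite big_nil; lia.
rewrite big_nat_recr //= expnS; have := le_M n; rewrite (addnC n t); lia.
Qed.

(** The t scales with j < t cost at most 3 * 1028 n each by the trivial bound q <= 2r; from j = t
    on, the square-root bound gives costs that halve at each scale. *)
Lemma mism_has_square (U : seq D) n t :
    (forall i, i < n -> f i \in U) -> size U <= 2 ^ t ->
  mism (has_square n) <= n * (3084 * t + 2 * 4112).
Proof.
move=> UT le_t; rewrite mism_orM.
have le_scale j m :
    (forall q, q <= (4 ^ j).*2 -> q ^ 2 <= 4 * size U ^ 2 * (4 ^ j).*2 -> q <= m) ->
    mism (scale n (4 ^ j)) * 4 ^ j <= 1028 * n * m.+1.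
  by move=> bound; apply: (mism_scale UT bound); rewrite expn_gt0.
rewrite -[n in iota 0 n]subn0 -/(index_iota 0 n).
rewrite (leq_trans (@sum_geometric_tail _ (3084 * n) (4112 * n) t n _ _)) //; last by lia.
  move=> j; have := le_scale j (4 ^ j).*2 (fun q le_q _ => le_q).
  have := expn_gt0 4 j; nia.
move=> i; set j := t + i.
have le_j : mism (scale n (4 ^ j)) * 2 ^ j <= 4112 * n * size U.
  have U0 : 0 < size U \/ n = 0.
    by case: (posnP n) => [->|/UT]; [right | case: (U); left].
  have p0 := expn_gt0 2 j; have E : 4 ^ j = 2 ^ j * 2 ^ j by rewrite -expnMn.
  (* Here q^2 <= 8 |U|^2 4^j <= (3 |U| 2^j)^2. *)
  have : mism (scale n (4 ^ j)) * 4 ^ j <= 1028 * n * (3 * size U * 2 ^ j).+1.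
    apply: le_scale => q _ le_q; rewrite -leq_sqr (leq_trans le_q) //.
    by rewrite E !expnMn !expnS !expn0; lia.
  rewrite [X in _ * X <= _]E.
  case: U0 => [U0|->]; last by rewrite muln0; nia.
  move: (mism _) (2 ^ j) p0 (size U) U0 => a b b0 u u0; nia.
have p0 := expn_gt0 2 t.
rewrite -(leq_pmul2r (m := 2 ^ t)) //.
rewrite -mulnA -expnD (addnC i) (leq_trans le_j) // leq_mul2l le_t orbT //.
Qed.

(** * Soundness and completeness of the square test *)

Definition square n s l :=
  [/\ 1 <= l, s + l.*2 <= n & forall k, k < l -> f (s + k) = f (s + l + k)].

Lemma run_scan_leftP x y k :
  reflect (k <= x /\ forall i, i < k -> f (x - i.+1) = f (y - i.+1))
          (k <= run (scan_left x y)).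
Proof.
rewrite run_scan find_map; apply: (iffP (find_iotaP _ _ _)) => -[le_kx eq_f]; split=> // i lt_ik.
  by apply/eqP; rewrite -[_ == _]negbK eq_f.
by rewrite /= negbK eq_f.
Qed.

Lemma run_check_pair n x y : x < y -> y <= n ->
  reflect (exists2 s, s <= x <= s + (y - x) & square n s (y - x)) (run (check_pair n x y)).
Proof.
move=> lt_xy le_yn; rewrite !run_bind run_scan_right /=.
have [p defp] : {p | p = y - x} by exists (y - x).
set right := lcp _ _ _; set left := run _; rewrite -defp.
have [le_right right_eq] := lcpP _ _ _ _ (leqnn right).
have [le_left left_eq] := run_scan_leftP _ _ _ (leqnn left).
apply: (iffP idP) => [le_p|[s /andP[le_sx lt_xs] [_ le_n eq_f]]].
  (* Capping the left extension at p keeps x at most p after the start. *)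
  exists (x - minn left p); first by lia.
  split; [lia | lia | move=> k lt_k].
  have [lt_x|ge_x] := ltnP (x - minn left p + k) x.
    set z := _ - _ in lt_x *; have := left_eq (x - (z + k)).-1.
    have ->: x - (x - (z + k)).-1.+1 = z + k by lia.
    have -> : y - (x - (z + k)).-1.+1 = z + p + k by lia.
    by apply; lia.
  set z := _ - _ in ge_x *; have := right_eq (z + k - x).
  have ->: x + (z + k - x) = z + k by lia.
  have ->: y + (z + k - x) = z + p + k by lia.
  by apply; lia.
have le1 : x - s <= left.
  apply/run_scan_leftP; split=> [|i lt_i]; first lia.
  have := eq_f (x - i.+1 - s).
  have ->: s + (x - i.+1 - s) = x - i.+1 by lia.
  have ->: s + p + (x - i.+1 - s) = y - i.+1 by lia.
  by apply; lia.
have le2 : s + p - x <= right.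
  apply/lcpP; split=> [|i lt_i]; first lia.
  have := eq_f (x + i - s).
  have ->: s + (x + i - s) = x + i by lia.
  have ->: s + p + (x + i - s) = y + i by lia.
  by apply; lia.
lia.
Qed.
Lemma mem_dense n r c x :
  (x \in dense n r c) = [&& x + r ^ 2 <= n, c * r ^ 2 <= x & x < c * r ^ 2 + r].
Proof. by rewrite mem_filter mem_iota. Qed.

Lemma mem_sparse n r c y :
  reflect [/\ y + r ^ 2 <= n & exists2 i, i < r & y = c * r ^ 2 + r * i] (y \in sparse n r c).
Proof.
rewrite mem_filter; apply: (iffP andP) => [[le_n /mapP[i]]|[le_n [i lt_i defy]]].
  by rewrite mem_iota => lt_i defy; split=> //; exists i.
by split=> //; apply/mapP; exists i; rewrite ?mem_iota.
Qed.

Lemma sparse_uniq n r c : uniq (sparse n r c).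
Proof.
apply: filter_uniq; case: r => // r.
by rewrite map_inj_uniq ?iota_uniq // => i j /addnI/eqP; rewrite eqn_pmul2l // => /eqP.
Qed.

Lemma run_window n r c b :
  run (window n r c b) = has (fun x => run (check_matches n x
    [seq y <- sparse n r (c + b) | (x < y) && (lcp (r ^ 2) x y == r ^ 2)])) (dense n r c).
Proof.
rewrite run_bind run_orM; apply: eq_in_has => x xX; congr (run (check_matches _ _ _)).
apply: eq_in_filter => y yY; rewrite run_lcp_table ?mem_cat ?xX ?yY ?orbT //.
Qed.

(** Two occurrences of a fragment of length h at distance at most h overlap or touch, so their
    distance is the period of a square. *)
Lemma square_of_close_match n h y z :
  y < z <= y + h -> z + h <= n -> lcp h y z = h -> square n y (z - y).
Proof.
move=> /andP[lt_yz le_zh] le_n eq_h; split; [lia | lia | move=> k lt_k].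
have /lcpP[_ ->] : h <= lcp h y z by rewrite eq_h.
  by congr f; lia.
lia.
Qed.

Lemma check_matches_sound n h x Q :
    uniq Q -> {in Q &, forall y z, y <= z + h} ->
    {in Q, forall y, [/\ x < y, y + h <= n & lcp h x y = h]} ->
  run (check_matches n x Q) -> exists s l, square n s l.
Proof.
case: Q => [|y [|z Q]] //= uniqQ close matchQ.
  have [lt_xy le_n _] := matchQ y (mem_head _ _).
  by case/run_check_pair => // [|s _ sq]; [lia | exists s, (y - x)].
have [[yQ zQ] neq_yz] : (y \in [:: y, z & Q] /\ z \in [:: y, z & Q]) /\ y <> z.
  rewrite !inE !eqxx orbT; split=> // eq_yz; move: uniqQ.
  by rewrite eq_yz inE eqxx.
have [_ le_yn eq_y] := matchQ y yQ; have [_ le_zn eq_z] := matchQ z zQ.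
have eq_yz : lcp h y z = h.
  apply/eqP; rewrite eqn_leq lcp_max /=.
  by have := lcp_trans h y x z; rewrite (lcpC h y x) eq_y eq_z minnn.
have := close y z yQ zQ; have := close z y zQ yQ => le_z le_y _.
have [lt_yz|lt_zy|//] := ltngtP y z.
  by exists y, (z - y); apply: (square_of_close_match (h := h)); rewrite ?lt_yz.
by exists z, (y - z); apply: (square_of_close_match (h := h)); rewrite ?lt_zy // lcpC.
Qed.

Lemma check_matches_complete n x y s Q :
    y \in Q -> x < y <= n -> s <= x <= s + (y - x) -> square n s (y - x) ->
  run (check_matches n x Q).
Proof.
case: Q => [|z [|z' Q]] //=; rewrite inE => /eqP <- /andP[lt_xy le_yn] sx sq.
by apply/run_check_pair => //; exists s.
Qed.

Lemma has_square_sound n : run (has_square n) -> exists s l, square n s l.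
Proof.
rewrite run_orM => /hasP[j _]; rewrite /scale; case: ifP => // _; move: (4 ^ j) => r.
rewrite run_orM => /hasP[c _]; rewrite run_orM => /hasP[b _].
rewrite run_window => /hasP[x _]; apply: (check_matches_sound (h := r ^ 2)).
- by rewrite filter_uniq ?sparse_uniq.
(* Sparse positions of one block are less than r^2 apart. *)
- move=> y z; rewrite mem_filter => /andP[_ /mem_sparse[_ [i lt_i ->]]].
  rewrite mem_filter => /andP[_ /mem_sparse[_ [k _ ->]]]; rewrite !expnS expn0; nia.
- by move=> y; rewrite [y \in _]mem_filter => /andP[/andP[-> /eqP->] /mem_sparse[]].
Qed.

Lemma scale_complete n r s p :
    0 < r -> p < 256 * r ^ 2 -> r = 1 \/ 3 * r ^ 2 <= p -> square n s p ->
  run (scale n r).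
Proof.
move=> r0 lt_p r1p sq; have [p0 le_n eq_f] := sq.
have h0 : 0 < r ^ 2 by rewrite expn_gt0 r0.
have le_hp : r ^ 2 <= p by case: r1p => [->|]; lia.
rewrite /scale; case: ifP => [_|]; last by lia.
(* Block c is the first one starting at or after s. *)
have [c [le_sc lt_c]] : exists c, s <= c * r ^ 2 /\ c * r ^ 2 < s + r ^ 2.
  exists ((s + (r ^ 2).-1) %/ r ^ 2).
  have := divn_eq (s + (r ^ 2).-1) (r ^ 2); have := ltn_pmod (s + (r ^ 2).-1) h0.
  move: (_ %/ _ * _) (_ %% _) => u v; lia.
(* The r dense positions of the block cover all residues modulo r. *)
have [x [le_cx lt_x dvd_y]] : exists x, [/\ c * r ^ 2 <= x, x < c * r ^ 2 + r & r %| x + p].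
  move: (c * r ^ 2) => a; exists (a + (r - (a + p) %% r) %% r).
  split; rewrite ?leq_addr ?ltn_add2l ?ltn_pmod //.
  rewrite /dvdn addnAC modnDmr -modnDml addnBA 1?ltnW ?ltn_pmod //.
  by rewrite addnC addnK modnn.
have le_r : r <= r ^ 2 by rewrite expnS expn1 leq_pmulr.
(* Since x < s + r^2 + r <= s + 2r^2, a period of at least 3r^2 leaves r^2 symbols of the first half
   after x; for r = 1, x = s. *)
have le_xn : x + r ^ 2 <= s + p.
  by case: r1p => [r1|]; [move: lt_c lt_x le_hp; rewrite r1 !exp1n; lia | lia].
have [b defb] : exists b, c + b = (x + p) %/ r ^ 2.
  by exists ((x + p) %/ r ^ 2 - c); rewrite subnKC // leq_divRL //; lia.
have yS : x + p \in sparse n r (c + b).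
  apply/mem_sparse; split; first lia.
  exists ((x + p) %% r ^ 2 %/ r); first by rewrite ltn_divLR // mulnn ltn_pmod.
  rewrite [r * _]mulnC divnK; first by rewrite defb -divn_eq.
  by rewrite /dvdn modn_dvdm ?dvdn_exp.
(* Indeed x < (c+1) r^2 and p < 256 r^2. *)
have le_b : b < 257.
  by rewrite -(ltn_add2l c) defb ltn_divLR // mulnDl; lia.
rewrite run_orM; apply/hasP; exists c.
  by rewrite mem_iota add0n ltnS leq_divRL //; lia.
rewrite run_orM; apply/hasP; exists b; first by rewrite mem_iota.
rewrite run_window; apply/hasP; exists x.
  by rewrite mem_dense le_cx lt_x !andbT; lia.
apply: (@check_matches_complete _ _ (x + p) s); rewrite ?addKn //; try lia.
rewrite mem_filter yS andbT; apply/andP; split; first lia.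
rewrite eqn_leq lcp_max /=; apply/lcpP; split=> // i lt_i.
have := eq_f (x + i - s); rewrite (_ : s + (x + i - s) = x + i); last by lia.
by rewrite (_ : s + p + (x + i - s) = x + p + i) => [->//|]; lia.
Qed.

(** With 16^k <= p < 16^(k+1), scale k-1 has r^2 = 16^(k-1), so 16 r^2 <= p < 256 r^2; k = 0 falls
    to r = 1. *)
Lemma has_square_complete n s p : square n s p -> run (has_square n).
Proof.
move=> sq; have [p0 le_n _] := sq.
have /andP[] := trunc_log_bounds (isT : 1 < 16) p0.
move: (trunc_log 16 p) => k le_k lt_k.
rewrite run_orM; apply/hasP; exists k.-1.
  by have := ltn_expl k (isT : 1 < 16); rewrite mem_iota; lia.
have E m : (4 ^ m) ^ 2 = 16 ^ m by rewrite -expnM mulnC expnM.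
apply: scale_complete sq; rewrite ?expn_gt0 ?E //.
  by apply: leq_trans lt_k _; case: (k) => //= k'; rewrite !expnS mulnA.
by case: k le_k {lt_k} => [|k'] /= le_k; [left | right; rewrite expnS in le_k; lia].
Qed.

End Semantics.

(** * From programs to comparison trees *)

(* Positions of the same colour are known to carry equal symbols. Out-of-range
   positions behave like onth T, which is None there. *)
Fixpoint to_tree n (col : {ffun 'I_n -> 'I_n}) (p : prog bool) : eq_tree n :=
  match p with
  | Ret b => Answer n b
  | Cmp i j k =>
      match insub i, insub j with
      | Some i', Some j' =>
          if col i' == col j' then to_tree col (k true) else
          Compare i' j'
            (to_tree [ffun z => if col z == col j' then col i' else col z] (k true))
            (to_tree col (k false))
      | None, None => to_tree col (k true)
      | _, _ => to_tree col (k false)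
      end
  end.

Section Trees.
Variables (n : nat) (Sigma : eqType) (T : n.-tuple Sigma).

Lemma onth_tnth (i : 'I_n) : onth T i = Some (tnth T i).
Proof. by rewrite onthE (nth_map (tnth T i)) ?size_tuple // -tnth_nth. Qed.

(** The number of colours is a potential: a comparison answered equal merges two colours and lowers
    it, and one answered unequal is counted by [mism]. *)
Lemma to_tree_correct (col : {ffun 'I_n -> 'I_n}) p :
    (forall i j, col i = col j -> tnth T i = tnth T j) ->
  answer T (to_tree col p) = run (onth T) p /\
  comparisons T (to_tree col p) <= mism (onth T) p + #|codom col|.
Proof.
have out i : ~~ (i < n) -> onth T i = None.
  by move=> i_ge; rewrite onth_default // size_tuple leqNgt.
elim: p col => [b|i j k IH] col colT //=.
case: insubP => [i' _ <-|i_ge]; case: insubP => [j' _ <-|j_ge].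
- rewrite !onth_tnth (inj_eq (pcan_inj (g := id) (fun=> erefl))) /=.
  case: ifP => [/eqP/colT->|/eqP neq_col] /=; first by rewrite eqxx; apply: IH.
  case: eqP => [eqT|neqT] /=; last first.
    by have [-> le_c] := IH false col colT; split=> //; rewrite add1n ltnS.
  set col' := finfun _.
  have [|-> le_c] := IH true col'.
    move=> u v; rewrite !ffunE; case: ifP => [/eqP/colT|_]; case: ifP => [/eqP/colT|_].
    - by move=> -> ->.
    - by move=> -> /colT <-.
    - by move=> -> /colT ->.
    - exact: colT.
  split=> //; rewrite add0n (leq_ltn_trans le_c) // ltn_add2l.
  (* Recolouring introduces no new colour and loses [col j']. *)
  apply/proper_card/properP; split.
    apply/subsetP => _ /codomP[z ->]; rewrite ffunE.
    by case: ifP => _; apply: codom_f.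
  exists (col j'); first exact: codom_f.
  apply/negP => /codomP[z]; rewrite ffunE; case: ifP => [_ /esym//|].
  by move=> + /esym/eqP => ->.
- rewrite onth_tnth (out j) //=.
  by have [eq_ans /leqW] := IH false col colT.
- rewrite onth_tnth (out i) //=.
  by have [eq_ans /leqW] := IH false col colT.
- by rewrite !out //= eqxx; apply: IH.
Qed.

Lemma square_atP s l : square_at T s l <-> square (onth T) n s l.
Proof.
rewrite /square_at /square size_tuple; split=> -[l0 le_n eq_f]; split=> //.
  move=> k lt_k; have := congr1 (fun u => onth u k) eq_f.
  by rewrite /fragment !onthE !map_take !map_drop !nth_take // !nth_drop.
apply: eq_from_onth => k; rewrite /fragment !onthE !map_take !map_drop.
have [lt_k|ge_k] := ltnP k l.
  by rewrite !nth_take // !nth_drop -!onthE eq_f.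
by rewrite !nth_default // size_take_min size_drop geq_min ge_k.
Qed.

Lemma num_symbols_bound i : i < n -> onth T i \in [seq Some a | a <- undup T].
Proof.
move=> lt_i; rewrite (onth_tnth (Ordinal lt_i)) map_f // mem_undup.
exact: mem_tnth.
Qed.

End Trees.

(** * The logarithmic bound and the theorem *)

Import Order.TTheory GRing.Theory Num.Theory.
Local Open Scope ring_scope.

(** For s > 1, 2^(up_log 2 s - 1) < s bounds all but 2 of the left side by the maximum, and that 2
    by twice the maximum. *)
Lemma up_log_le_ln (R : realType) (s : nat) :
  (up_log 2 s).+1%:R <= 3%:R * Num.max 1 (ln s%:R / ln 2) :> R.
Proof.
set M := Num.max _ _; have M1 : 1 <= M by rewrite le_max lexx.
have [s1|s1] := leqP s 1.
  have -> : up_log 2 s = 0%N by apply/eqP; rewrite up_log_eq0.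
  by rewrite -[1%:R]mulr1 ler_pM // ler_nat.
have ln2 : 0 < ln 2 :> R by rewrite ln_gt0 // ltr1n.
have le_log : (up_log 2 s).-1%:R <= M.
  rewrite le_max; apply/orP; right; rewrite ler_pdivlMr // mulrC mulr_natr -lnXn //.
  rewrite ler_ln ?posrE ?exprn_gt0 ?ltr0n ?(ltnW s1) // -natrX ler_nat ltnW //.
  by have /andP[] := up_log_bounds (isT : (1 < 2)%N) s1.
have -> : (up_log 2 s).+1 = ((up_log 2 s).-1 + 2)%N.
  by rewrite addn2 prednK // up_log_gt0.
rewrite natrD (_ : 3%:R = 1 + 2%:R); last by rewrite -natr1 addrC.
rewrite mulrDl mul1r lerD // -[X in X <= _]mulr1 ler_pM //.
Qed.

Theorem theorem2 (R : realType) :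
  exists (A : forall n : nat, eq_tree n) (C : R),
    forall (n : nat) (Sigma : eqType) (T : n.-tuple Sigma),
      (answer T (A n) <-> square_free T) /\
      (comparisons T (A n))%:R <= C * n_log R n (num_symbols T).
Proof.
(* The final 1 in K pays for the at most n merges; the factor 3 below comes from [up_log_le_ln]. *)
pose K := (3084 + 2 * 4112 + 1)%N.
exists (fun n => to_tree [ffun i => i] (bind (has_square n) (fun b => Ret (~~ b)))), (K * 3)%:R.
move=> n Sigma T; set p := bind _ _.
have [|eq_ans le_cmp] := @to_tree_correct n Sigma T [ffun i => i] p.
  by move=> i j; rewrite !ffunE => ->.
split.
  rewrite eq_ans run_bind /=; split=> [/negP no_sq s l /square_atP sq|sqfree].
    exact: no_sq (has_square_complete sq).
  by apply/negP => /has_square_sound[s [l /square_atP]]; apply: sqfree.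
have le_log := up_log_le_ln R (num_symbols T).
have le_mism := mism_has_square (@num_symbols_bound _ _ T) (t := up_log 2 (num_symbols T)).
have {}le_cmp : (comparisons T (to_tree [ffun i => i] p) <= K * (up_log 2 (num_symbols T)).+1 * n)%N.
  apply: leq_trans le_cmp _; rewrite mism_bind /= addn0.
  have le_n := max_card (mem (codom [ffun i : 'I_n => i])); rewrite card_ord in le_n.
  rewrite size_map up_logP // in le_mism.
  apply: leq_trans (leq_add (le_mism isT) le_n) _.
  rewrite -mulnSr mulnC leq_mul2r mulnS -addnS; apply/orP; right.
  by rewrite /K; move: (up_log _ _) => t; lia.
rewrite (le_trans (_ : _ <= (K * (up_log 2 (num_symbols T)).+1 * n)%:R)) ?ler_nat //.
rewrite /n_log !natrM [n%:R * _]mulrC mulrA ler_wpM2r // -mulrA ler_wpM2l //.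
Qed.
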